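(* (Class II solutions.) Let $A\neq0$, $D>0$, $R>0$, $F$, $C$ be real constants, set $\Phi(r)=F-DR^2\left(1-\frac{r^2}{R^2}\right)^{1/2}$ and $e^{-\alpha}=1-\frac{r^2}{R^2}$, and let $I\subset(0,R)$ be an open interval on which $0<-A^2\Phi(r)<1$. Then $$e^{\omega}=\frac1{A^4}\left[\ln\left(-A^2\Phi\right)\right]^2,\qquad Q=\pm\frac{Dr^3}{\sqrt2\,\Phi}\left[-\ln(-A^2\Phi)\right]^{-1/2},$$ $$\kappa\rho=\frac3{R^2}-\frac{D^2r^2}{2\Phi^2}\left[-\ln(-A^2\Phi)\right]^{-1},$$ $$\kappa p=-\frac1{R^2}+\frac{D}{\Phi^2}\left[-\ln(-A^2\Phi)\right]^{-1}\left[\tfrac12Dr^2-2\left(1-\frac{r^2}{R^2}\right)^{1/2}\Phi\right]$$ is a solution on $I$ of the static spherically symmetric Einstein–Maxwell perfect fluid equations, with $\kappa\rho+\frac{Q^2}{r^4}=\frac3{R^2}$ and with electric potential $\phi$ satisfying the functional relation $\frac{\sqrt2A}{3}e^{\frac34\omega}=C+\phi$.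
   Context: The metric is $ds^2=e^{\alpha(r)}dr^2+r^2(d\theta^2+\sin^2\theta\,d\varphi^2)-e^{\omega(r)}dt^2$, $p$ and $\rho$ are the (isotropic) matter pressure and density, $\phi(r)$ is the electric potential, $Q(r)=r^2\phi'e^{-\frac12(\alpha+\omega)}$ is the charge inside radius $r$, $\kappa>0$ is a constant and $'=d/dr$. The static spherically symmetric Einstein–Maxwell perfect fluid equations are $$\kappa p-\frac{Q^2}{r^4}=-\frac1{r^2}+\frac{e^{-\alpha}}{r^2}(1+r\omega'),$$ $$\kappa p+\frac{Q^2}{r^4}=e^{-\alpha}\left(\tfrac12\omega''-\tfrac14\alpha'\omega'+\tfrac14\omega'^2+\frac{\omega'-\alpha'}{2r}\right),$$ $$\kappa\rho+\frac{Q^2}{r^4}=\frac1{r^2}-\frac{e^{-\alpha}}{r^2}(1-r\alpha').$$ The sign in $Q$ is determined by the sign of $A$. *)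

(* Defs.v *)
From Stdlib Require Import Reals.
From Coquelicot Require Import Coquelicot.
Open Scope R_scope.

Definition charge (alpha omega phi : R -> R) (r : R) : R :=
  r ^ 2 * Derive phi r * exp (- (1 / 2) * (alpha r + omega r)).

(** [Derive] is total, so the differentiability of the metric functions and of
    the potential has to be part of the notion of solution. *)
Record EM_fluid_solution (kappa a b : R)
    (alpha omega phi p rho Q : R -> R) : Prop := {
  em_alpha_diff : forall r, a < r < b -> ex_derive alpha r;
  em_omega_diff : forall r, a < r < b -> ex_derive omega r;
  em_omega_diff2 : forall r, a < r < b -> ex_derive (Derive omega) r;
  em_phi_diff : forall r, a < r < b -> ex_derive phi r;
  em_charge : forall r, a < r < b -> Q r = charge alpha omega phi r;
  em_radial : forall r, a < r < b ->
    kappa * p r - Q r ^ 2 / r ^ 4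
    = - (1 / r ^ 2) + exp (- alpha r) / r ^ 2 * (1 + r * Derive omega r);
  em_tangential : forall r, a < r < b ->
    kappa * p r + Q r ^ 2 / r ^ 4
    = exp (- alpha r) *
      (1 / 2 * Derive (Derive omega) r
       - 1 / 4 * Derive alpha r * Derive omega r
       + 1 / 4 * Derive omega r ^ 2
       + (Derive omega r - Derive alpha r) / (2 * r));
  em_density : forall r, a < r < b ->
    kappa * rho r + Q r ^ 2 / r ^ 4
    = 1 / r ^ 2 - exp (- alpha r) / r ^ 2 * (1 - r * Derive alpha r)
}.

(** The constant [R] of the paper is written [Rc], as [R] is the type of reals. *)
Definition Phi (D F Rc : R) (r : R) : R :=
  F - D * Rc ^ 2 * sqrt (1 - r ^ 2 / Rc ^ 2).

(** The sign in [Q] is [- sign A]: since [Phi < 0 < D] where the logarithm is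
    defined, this makes [Q] have the sign of [A], which is what
    [sqrt 2 * A / 3 * exp (3 / 4 * omega) = C + phi] forces. *)
Record class_II (A D F Rc kappa a b : R)
    (alpha omega p rho Q : R -> R) : Prop := {
  cII_alpha : forall r, a < r < b -> exp (- alpha r) = 1 - r ^ 2 / Rc ^ 2;
  cII_omega : forall r, a < r < b ->
    exp (omega r) = 1 / A ^ 4 * ln (- A ^ 2 * Phi D F Rc r) ^ 2;
  cII_Q : forall r, a < r < b ->
    Q r = - sign A * (D * r ^ 3 / (sqrt 2 * Phi D F Rc r)
                      * / sqrt (- ln (- A ^ 2 * Phi D F Rc r)));
  cII_rho : forall r, a < r < b ->
    kappa * rho r
    = 3 / Rc ^ 2
      - D ^ 2 * r ^ 2 / (2 * Phi D F Rc r ^ 2)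
        * / (- ln (- A ^ 2 * Phi D F Rc r));
  cII_p : forall r, a < r < b ->
    kappa * p r
    = - (1 / Rc ^ 2)
      + D / Phi D F Rc r ^ 2 * / (- ln (- A ^ 2 * Phi D F Rc r))
        * (1 / 2 * D * r ^ 2
           - 2 * sqrt (1 - r ^ 2 / Rc ^ 2) * Phi D F Rc r)
}.

(* Main.v *)
(** With [s = sqrt (1 - r^2 / R^2)] and [L = - ln (- A^2 Phi)] one has
    [Phi' = D r / s] and [L' = - Phi' / Phi], so that [e^omega = L^2 / A^4] gives
    [omega' = - 2 D r / (s Phi L)]. The functional relation determines the
    potential, [e^(-alpha/2) = s] and [e^(omega/4) = sqrt L / |A|] turn its
    derivative into the stated charge, with [Q^2 / r^4 = D^2 r^2 / (2 Phi^2 L)],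
    and the field equations become identities between rational functions of
    [r], [s], [Phi] and [L], modulo [s^2 = 1 - r^2 / R^2]. *)

Require Import Defs.
From Stdlib Require Import Reals Lra.
From Coquelicot Require Import Coquelicot.
Open Scope R_scope.

(** * Signs, neighbourhoods and square roots *)

Lemma Rabs_sign (x : R) : x = sign x * Rabs x.
Proof.
  destruct (Rtotal_order x 0) as [H | [-> | H]].
  - rewrite sign_eq_m1, Rabs_left by exact H; ring.
  - rewrite Rabs_R0; ring.
  - rewrite sign_eq_1, Rabs_right by lra; ring.
Qed.

Lemma locally_Ioo (P : R -> Prop) (a b r : R) :
  (forall x, a < x < b -> P x) -> a < r < b -> locally r P.
Proof.
  intros HP [Har Hrb].
  apply (locally_interval P r a b Har Hrb).
  intros y Hay Hyb; apply HP; split; assumption.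
Qed.

(** Serves to differentiate [alpha], [omega] and [Derive omega], which agree with explicit formulas
    only inside the interval. *)
Lemma is_derive_ext_Ioo (f g : R -> R) (a b r l : R) :
  (forall x, a < x < b -> f x = g x) -> a < r < b ->
  is_derive f r l -> is_derive g r l.
Proof.
  intros Hfg Hr; apply is_derive_ext_loc.
  exact (locally_Ioo _ a b r Hfg Hr).
Qed.

Lemma exp_half (x : R) : exp (x / 2) = sqrt (exp x).
Proof.
  rewrite <- (sqrt_Rsqr (exp (x / 2))) by (left; apply exp_pos).
  unfold Rsqr; rewrite <- exp_plus.
  f_equal; f_equal; field.
Qed.

Lemma one_sub_sqr_div_pos (r Rc : R) : 0 < r < Rc -> 0 < 1 - r ^ 2 / Rc ^ 2.
Proof.
  intros [Hr HrR].
  replace (1 - r ^ 2 / Rc ^ 2) with ((Rc - r) * (Rc + r) / Rc ^ 2)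
    by (field; lra).
  apply Rdiv_lt_0_compat; [apply Rmult_lt_0_compat; lra | apply pow_lt; lra].
Qed.

(** * Derivatives of the square root, of [Phi] and of its logarithm *)

Definition spatial_factor (Rc r : R) : R := sqrt (1 - r ^ 2 / Rc ^ 2).

Definition neg_ln_Phi (A D F Rc r : R) : R := - ln (- A ^ 2 * Phi D F Rc r).

Lemma is_derive_spatial_factor (Rc r : R) :
  Rc <> 0 -> 0 < 1 - r ^ 2 / Rc ^ 2 ->
  is_derive (spatial_factor Rc) r (- r / (Rc ^ 2 * spatial_factor Rc r)).
Proof.
  intros HR Hpos; unfold spatial_factor.
  pose proof (sqrt_lt_R0 _ Hpos) as Hs.
  apply (is_derive_ext (fun x => sqrt (1 - x * x / Rc ^ 2)));
    [intros x; f_equal; field; exact HR|].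
  replace (r ^ 2) with (r * r) in * by ring.
  evar_last; [apply is_derive_comp|].
  - apply is_derive_Reals, derivable_pt_lim_sqrt; exact Hpos.
  - instantiate (1 := - (2 * r / Rc ^ 2)).
    auto_derive; [trivial | field; exact HR].
  - set (s := sqrt _) in *; clearbody s.
    unfold scal; simpl; unfold mult; simpl.
    field; split; [lra | exact HR].
Qed.

Lemma is_derive_Phi (D F Rc r : R) : Rc <> 0 -> 0 < 1 - r ^ 2 / Rc ^ 2 ->
  is_derive (Phi D F Rc) r (D * r / spatial_factor Rc r).
Proof.
  intros HR Hpos.
  pose proof (sqrt_lt_R0 _ Hpos) as Hs.
  (* With an abstract [f], [auto_derive] handles only the affine outer layer and does not expand the
     square root. *)
  assert (Haff : forall (f : R -> R) (l : R), is_derive f r l ->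
      is_derive (fun x => F - D * Rc ^ 2 * f x) r (- (D * Rc ^ 2 * l))).
  { intros f l Hd; auto_derive; [exists l; exact Hd|].
    replace (Derive (fun x => f x) r) with l
      by (symmetry; apply is_derive_unique; exact Hd).
    ring. }
  evar_last; [exact (Haff _ _ (is_derive_spatial_factor Rc r HR Hpos))|].
  fold (spatial_factor Rc r) in Hs.
  set (s := spatial_factor Rc r) in *; clearbody s.
  simpl; field; split; [lra | exact HR].
Qed.

Lemma is_derive_neg_ln_Phi (A D F Rc r : R) : A <> 0 -> Rc <> 0 ->
  0 < 1 - r ^ 2 / Rc ^ 2 -> 0 < - A ^ 2 * Phi D F Rc r ->
  is_derive (neg_ln_Phi A D F Rc) r
    (- (D * r) / (spatial_factor Rc r * Phi D F Rc r)).
Proof.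
  intros HA HR Hpos Hu.
  pose proof (sqrt_lt_R0 _ Hpos) as Hs.
  pose proof (is_derive_Phi D F Rc r HR Hpos) as Hd.
  fold (spatial_factor Rc r) in Hs; unfold neg_ln_Phi.
  set (s := spatial_factor Rc r) in *; set (f := Phi D F Rc) in *.
  clearbody s f.
  assert (Hf : f r <> 0) by (intros E; rewrite E in Hu; lra).
  auto_derive; [split; [exists (D * r / s); exact Hd | split; [exact Hu | trivial]]|].
  replace (Derive (fun x => f x) r) with (D * r / s)
    by (symmetry; apply is_derive_unique; exact Hd).
  field; repeat split; auto; lra.
Qed.

(** Squaring removes the sign and both square roots, so the field equations see the charge only
    through a rational function. *)
Lemma charge_sqr (A D P L r : R) : A <> 0 -> r <> 0 -> P < 0 -> 0 < L ->
  (- sign A * (D * r ^ 3 / (sqrt 2 * P) * / sqrt L)) ^ 2 / r ^ 4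
  = D ^ 2 * r ^ 2 / (2 * P ^ 2 * L).
Proof.
  intros HA Hr HP HL.
  assert (Hq : 0 < sqrt L) by (apply sqrt_lt_R0, HL).
  assert (H2 : 0 < sqrt 2) by (apply sqrt_lt_R0; lra).
  assert (Hg : (sign A) ^ 2 = 1).
  { destruct (Rdichotomy _ _ HA);
      [rewrite sign_eq_m1 by assumption | rewrite sign_eq_1 by assumption];
      ring. }
  transitivity ((sign A) ^ 2 * D ^ 2 * r ^ 2
                / ((sqrt 2 * sqrt 2) * P ^ 2 * (sqrt L * sqrt L))).
  - field; repeat split; auto; lra.
  - rewrite Hg, !sqrt_sqrt by lra; field; repeat split; auto; lra.
Qed.

(** * The metric functions and their derivatives *)

Section ClassII.

Variables (A D Rc F a b : R) (alpha omega : R -> R).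
Hypothesis hA : A <> 0.
Hypothesis hRc : 0 < Rc.
Hypothesis ha : 0 <= a.
Hypothesis hb : b <= Rc.
Hypothesis hPhi : forall r, a < r < b -> 0 < - A ^ 2 * Phi D F Rc r < 1.
Hypothesis halpha : forall r, a < r < b -> exp (- alpha r) = 1 - r ^ 2 / Rc ^ 2.
Hypothesis homega : forall r, a < r < b ->
  exp (omega r) = 1 / A ^ 4 * ln (- A ^ 2 * Phi D F Rc r) ^ 2.

Local Notation s := (spatial_factor Rc).
Local Notation L := (neg_ln_Phi A D F Rc).

Lemma one_sub_sqr_div_pos_Ioo (r : R) : a < r < b -> 0 < 1 - r ^ 2 / Rc ^ 2.
Proof. intros Hr; apply one_sub_sqr_div_pos; lra. Qed.

Lemma spatial_factor_pos (r : R) : a < r < b -> 0 < s r.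
Proof. intros Hr; apply sqrt_lt_R0, one_sub_sqr_div_pos_Ioo, Hr. Qed.

Lemma spatial_factor_sqr (r : R) : a < r < b -> s r ^ 2 = 1 - r ^ 2 / Rc ^ 2.
Proof.
  intros Hr; unfold spatial_factor; rewrite <- Rsqr_pow2.
  apply Rsqr_sqrt; left; apply one_sub_sqr_div_pos_Ioo, Hr.
Qed.

Lemma neg_ln_Phi_pos (r : R) : a < r < b -> 0 < L r.
Proof.
  intros Hr; destruct (hPhi r Hr) as [H0 H1].
  pose proof (ln_increasing _ _ H0 H1) as H.
  rewrite ln_1 in H; unfold neg_ln_Phi; lra.
Qed.

Lemma Phi_neg (r : R) : a < r < b -> Phi D F Rc r < 0.
Proof.
  intros Hr; destruct (hPhi r Hr) as [H0 _].
  assert (HA2 : 0 < A ^ 2) by (apply pow2_gt_0; exact hA).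
  nra.
Qed.

Lemma is_derive_neg_ln_Phi_Ioo (r : R) : a < r < b ->
  is_derive L r (- (D * r) / (s r * Phi D F Rc r)).
Proof.
  intros Hr; apply is_derive_neg_ln_Phi;
    [exact hA | lra | apply one_sub_sqr_div_pos_Ioo, Hr | apply hPhi, Hr].
Qed.

Lemma is_derive_alpha (r : R) : a < r < b ->
  is_derive alpha r (2 * r / (Rc ^ 2 * s r ^ 2)).
Proof.
  intros Hr.
  apply (is_derive_ext_Ioo (fun x => - ln (1 - x ^ 2 / Rc ^ 2)) _ a b);
    [|exact Hr|].
  - intros x Hx; rewrite <- (halpha x Hx), ln_exp; ring.
  - rewrite (spatial_factor_sqr r Hr).
    pose proof (one_sub_sqr_div_pos_Ioo r Hr) as Hpos.
    assert (HR2 : 0 < Rc ^ 2) by (apply pow_lt; exact hRc).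
    (* This is the denominator left after clearing the inner fraction [r ^ 2 / Rc ^ 2]. *)
    assert (Hne : Rc ^ 2 - r ^ 2 <> 0).
    { replace (Rc ^ 2 - r ^ 2) with (Rc ^ 2 * (1 - r ^ 2 / Rc ^ 2))
        by (field; lra).
      apply Rmult_integral_contrapositive_currified; lra. }
    auto_derive; [exact Hpos | field; repeat split; auto; lra].
Qed.

(** Logarithmic differentiation of [L ^ 2 / A ^ 4]: the constant factor drops out and [2 * L' / L]
    remains. *)
Lemma is_derive_omega (r : R) : a < r < b ->
  is_derive omega r (- 2 * (D * r) / (s r * Phi D F Rc r * L r)).
Proof.
  intros Hr.
  apply (is_derive_ext_Ioo (fun x => ln (1 / A ^ 4 * L x ^ 2)) _ a b);
    [|exact Hr|].
  - intros x Hx; rewrite <- (ln_exp (omega x)), (homega x Hx).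
    f_equal; unfold neg_ln_Phi; ring.
  - pose proof (is_derive_neg_ln_Phi_Ioo r Hr) as HdL.
    pose proof (neg_ln_Phi_pos r Hr) as HL.
    pose proof (spatial_factor_pos r Hr) as Hs.
    pose proof (Phi_neg r Hr) as HP.
    assert (HA4 : 0 < A ^ 4) by (replace (A ^ 4) with ((A ^ 2) ^ 2) by ring;
      apply pow2_gt_0, pow_nonzero, hA).
    set (l := - (D * r) / (s r * Phi D F Rc r)) in *.
    replace (- 2 * (D * r) / (s r * Phi D F Rc r * L r)) with (2 * l / L r)
      by (unfold l; field; repeat split; auto; lra).
    set (f := neg_ln_Phi A D F Rc) in *; clearbody l f.
    auto_derive.
    + split; [exists l; exact HdL | split; [|trivial]].
      apply Rmult_lt_0_compat; [apply Rdiv_lt_0_compat; lra | nra].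
    + replace (Derive (fun x => f x) r) with l
        by (symmetry; apply is_derive_unique; exact HdL).
      field; repeat split; auto; lra.
Qed.

(** The four terms come, in this order, from differentiating the factors [r], [s], [Phi] and [L] of
    the quotient for [omega']. *)
Lemma is_derive_Derive_omega (r : R) : a < r < b ->
  is_derive (Derive omega) r
    (- 2 * D / (s r * Phi D F Rc r * L r)
     - 2 * D * r ^ 2 / (Rc ^ 2 * s r ^ 3 * Phi D F Rc r * L r)
     + 2 * D ^ 2 * r ^ 2 / (s r ^ 2 * Phi D F Rc r ^ 2 * L r)
     - 2 * D ^ 2 * r ^ 2 / (s r ^ 2 * Phi D F Rc r ^ 2 * L r ^ 2)).
Proof.
  intros Hr.
  apply (is_derive_ext_Ioo
    (fun x => - 2 * (D * x) / (s x * Phi D F Rc x * L x)) _ a b); [|exact Hr|].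
  - intros x Hx; symmetry; apply is_derive_unique, is_derive_omega, Hx.
  - pose proof (is_derive_neg_ln_Phi_Ioo r Hr) as HdL.
    pose proof (neg_ln_Phi_pos r Hr) as HL.
    pose proof (spatial_factor_pos r Hr) as Hs.
    pose proof (Phi_neg r Hr) as HP.
    assert (HR : Rc <> 0) by lra.
    pose proof (is_derive_Phi D F Rc r HR (one_sub_sqr_div_pos_Ioo r Hr)) as HdP.
    assert (Hds : is_derive s r (- r / (Rc ^ 2 * s r)))
      by exact (is_derive_spatial_factor Rc r HR (one_sub_sqr_div_pos_Ioo r Hr)).
    set (P := Phi D F Rc) in *.
    set (f := neg_ln_Phi A D F Rc) in *; set (g := spatial_factor Rc) in *.
    clearbody P f g.
    auto_derive.
    + repeat split; try (eexists; eassumption).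
      repeat apply Rmult_integral_contrapositive_currified; lra.
    + replace (Derive (fun x => g x) r) with (- r / (Rc ^ 2 * g r))
        by (symmetry; apply is_derive_unique; exact Hds).
      replace (Derive (fun x => P x) r) with (D * r / g r)
        by (symmetry; apply is_derive_unique; exact HdP).
      replace (Derive (fun x => f x) r) with (- (D * r) / (g r * P r))
        by (symmetry; apply is_derive_unique; exact HdL).
      field; repeat split; auto; lra.
Qed.

(** * The potential and its charge *)

Lemma exp_half_alpha (r : R) : a < r < b -> exp (- alpha r / 2) = s r.
Proof. intros Hr; rewrite exp_half, (halpha r Hr); reflexivity. Qed.

(** Two successive square roots of [L ^ 2 / A ^ 4]. The first is [L / A ^ 2], as [L] is positive;
    the second produces [Rabs A], and the quotient [A / Rabs A] later becomes the sign in the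
    charge. *)
Lemma exp_quarter_omega (r : R) : a < r < b ->
  exp (omega r / 4) = sqrt (L r) / Rabs A.
Proof.
  intros Hr; pose proof (neg_ln_Phi_pos r Hr) as HL.
  assert (HA2 : 0 < A ^ 2) by (apply pow2_gt_0; exact hA).
  replace (omega r / 4) with (omega r / 2 / 2) by field.
  rewrite 2!exp_half, (homega r Hr).
  replace (1 / A ^ 4 * ln (- A ^ 2 * Phi D F Rc r) ^ 2)
    with (Rsqr (L r / A ^ 2)) by (unfold neg_ln_Phi, Rsqr; field; exact hA).
  rewrite sqrt_Rsqr by (left; apply Rdiv_lt_0_compat; assumption).
  rewrite sqrt_div_alt by exact HA2.
  rewrite <- Rsqr_pow2, sqrt_Rsqr_abs; reflexivity.
Qed.

Lemma is_derive_potential (C r : R) : a < r < b ->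
  is_derive (fun x => sqrt 2 * A / 3 * exp (3 / 4 * omega x) - C) r
    (sqrt 2 * A / 4 * (- 2 * (D * r) / (s r * Phi D F Rc r * L r))
     * exp (3 / 4 * omega r)).
Proof.
  intros Hr; pose proof (is_derive_omega r Hr) as Hd.
  set (l := _ / (s r * _ * _)) in *; clearbody l.
  auto_derive; [exists l; exact Hd|].
  replace (Derive (fun x => omega x) r) with l
    by (symmetry; apply is_derive_unique; exact Hd).
  field.
Qed.

Lemma charge_potential (C r : R) : a < r < b ->
  charge alpha omega (fun x => sqrt 2 * A / 3 * exp (3 / 4 * omega x) - C) r
  = - sign A * (D * r ^ 3 / (sqrt 2 * Phi D F Rc r) * / sqrt (L r)).
Proof.
  intros Hr; unfold charge.
  rewrite (is_derive_unique
    (fun x : R => sqrt 2 * A / 3 * exp (3 / 4 * omega x) - C) r _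
    (is_derive_potential C r Hr)).
  pose proof (neg_ln_Phi_pos r Hr) as HL.
  pose proof (spatial_factor_pos r Hr) as Hs.
  pose proof (Phi_neg r Hr) as HP.
  set (c := sqrt 2 * A / 4 * (- 2 * (D * r) / (s r * Phi D F Rc r * L r))).
  (* The exponents combine as [3/4 - 1/2 = 1/4] for [omega] and [-1/2] for [alpha]. *)
  transitivity (r ^ 2 * c * (exp (omega r / 4) * exp (- alpha r / 2))).
  { replace (exp (omega r / 4) * exp (- alpha r / 2))
      with (exp (3 / 4 * omega r) * exp (- (1 / 2) * (alpha r + omega r)))
      by (rewrite <- !exp_plus; f_equal; field).
    ring. }
  rewrite (exp_quarter_omega r Hr), (exp_half_alpha r Hr).
  unfold c; clear c.
  (* [L] contains [A], so it is made opaque before [A] is rewritten as [sign A * Rabs A]. *)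
  set (l := L r) in *; clearbody l.
  assert (Hq : 0 < sqrt l) by (apply sqrt_lt_R0, HL).
  assert (H2 : 0 < sqrt 2) by (apply sqrt_lt_R0; lra).
  assert (HAabs : A = sign A * Rabs A) by apply Rabs_sign.
  assert (HAp : Rabs A <> 0) by (apply Rabs_no_R0; exact hA).
  set (g := sign A) in *; set (B := Rabs A) in *; clearbody g B.
  rewrite HAabs.
  (* With [l] written as [q ^ 2], the goal is rational in [q], and [q / q ^ 2] gives the inverse
     root of the charge. *)
  assert (EL : l = sqrt l ^ 2)
    by (rewrite <- Rsqr_pow2, Rsqr_sqrt; [reflexivity | lra]).
  set (q := sqrt l) in *; rewrite EL.
  clearbody q.
  assert (E2 : sqrt 2 / 2 = / sqrt 2).
  { apply (Rmult_eq_reg_r (sqrt 2)); [|lra].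
    rewrite Rinv_l by lra.
    replace (sqrt 2 / 2 * sqrt 2) with (sqrt 2 * sqrt 2 / 2) by field.
    rewrite sqrt_sqrt; lra. }
  transitivity (- g * (D * r ^ 3 * (sqrt 2 / 2) / (Phi D F Rc r * q))).
  - field; repeat split; auto; lra.
  - rewrite E2; field; repeat split; lra.
Qed.

End ClassII.

(** * Verification of the field equations *)

Theorem mainTheorem9 (A D Rc F C kappa a b : R)
    (alpha omega p rho Q : R -> R)
    (hA : A <> 0) (hD : 0 < D) (hRc : 0 < Rc) (hkappa : 0 < kappa)
    (ha : 0 <= a) (hab : a < b) (hb : b <= Rc)
    (hPhi : forall r, a < r < b -> 0 < - A ^ 2 * Phi D F Rc r < 1)
    (hII : class_II A D F Rc kappa a b alpha omega p rho Q) :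
  exists phi : R -> R,
    EM_fluid_solution kappa a b alpha omega phi p rho Q /\
    (forall r, a < r < b -> kappa * rho r + Q r ^ 2 / r ^ 4 = 3 / Rc ^ 2) /\
    (forall r, a < r < b ->
       sqrt 2 * A / 3 * exp (3 / 4 * omega r) = C + phi r).
Proof.
  destruct hII as [halpha homega hQ hrho hp].
  pose proof (is_derive_alpha Rc a b alpha hRc ha hb halpha) as Hda.
  pose proof (is_derive_omega A D Rc F a b omega hA hRc ha hb hPhi homega)
    as Hdw.
  pose proof (is_derive_Derive_omega A D Rc F a b omega hA hRc ha hb hPhi homega)
    as Hddw.
  pose proof (spatial_factor_pos Rc a b ha hb) as Hs.
  pose proof (spatial_factor_sqr Rc a b ha hb) as Hs2.
  pose proof (neg_ln_Phi_pos A D Rc F a b hPhi) as HL.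
  pose proof (Phi_neg A D Rc F a b hA hPhi) as HP.
  unfold spatial_factor, neg_ln_Phi in *.
  assert (HQ2 : forall r, a < r < b -> Q r ^ 2 / r ^ 4
      = D ^ 2 * r ^ 2 / (2 * Phi D F Rc r ^ 2 * - ln (- A ^ 2 * Phi D F Rc r))).
  { intros r Hr; rewrite (hQ r Hr).
    apply charge_sqr; [exact hA | lra | apply HP, Hr | apply HL, Hr]. }
  (* The term subtracted in [kappa * rho] is exactly [Q ^ 2 / r ^ 4]. *)
  assert (Hdens : forall r, a < r < b ->
      kappa * rho r + Q r ^ 2 / r ^ 4 = 3 / Rc ^ 2).
  { intros r Hr; rewrite (HQ2 r Hr), (hrho r Hr).
    specialize (HL r Hr); specialize (HP r Hr).
    field; repeat split; auto; lra. }
  (* The functional relation solved for the potential. *)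
  exists (fun x => sqrt 2 * A / 3 * exp (3 / 4 * omega x) - C).
  split; [|split; [exact Hdens | intros; ring]].
  split.
  - intros r Hr; eexists; apply Hda, Hr.
  - intros r Hr; eexists; apply Hdw, Hr.
  - intros r Hr; eexists; apply Hddw, Hr.
  - intros r Hr; eexists.
    apply (is_derive_potential A D Rc F a b omega); assumption.
  - intros r Hr; rewrite (hQ r Hr); symmetry.
    apply (charge_potential A D Rc F a b); assumption.
  - intros r Hr.
    rewrite (HQ2 r Hr), (hp r Hr), (halpha r Hr).
    rewrite (is_derive_unique _ _ _ (Hdw r Hr)).
    specialize (HL r Hr); specialize (HP r Hr).
    specialize (Hs r Hr); specialize (Hs2 r Hr).
    set (s := sqrt (1 - r ^ 2 / Rc ^ 2)) in *; rewrite <- Hs2.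
    (* Here [L] is the logarithm itself, which is negative; the positive quantity is [- L]. *)
    set (L := ln _) in *; set (P := Phi D F Rc r) in *.
    clearbody s L P.
    (* [field] does not know [s ^ 2 = 1 - r ^ 2 / Rc ^ 2], so the relation is applied by hand to the
       only term where [s ^ 2] survives. The rest is linear in [s] and matches the pressure. *)
    replace (s ^ 2 / r ^ 2 * (1 + r * (- 2 * (D * r) / (s * P * - L))))
      with ((1 - r ^ 2 / Rc ^ 2) / r ^ 2 - 2 * s * D / (P * - L))
      by (rewrite <- Hs2; field; repeat split; auto; lra).
    field; repeat split; auto; lra.
  - intros r Hr.
    rewrite (HQ2 r Hr), (hp r Hr), (halpha r Hr).
    rewrite (is_derive_unique _ _ _ (Hddw r Hr)).
    rewrite (is_derive_unique _ _ _ (Hdw r Hr)).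
    rewrite (is_derive_unique _ _ _ (Hda r Hr)).
    specialize (HL r Hr); specialize (HP r Hr).
    specialize (Hs r Hr); specialize (Hs2 r Hr).
    set (s := sqrt (1 - r ^ 2 / Rc ^ 2)) in *; rewrite <- Hs2.
    set (L := ln _) in *; set (P := Phi D F Rc r) in *.
    clearbody s L P.
    (* The [1 / (Rc ^ 2 * s)] part of [omega''] cancels against [alpha' * omega'], and its
       [1 / L ^ 2] part against [omega' ^ 2]. What remains holds with [s] as a free variable. *)
    field; repeat split; auto; lra.
  - intros r Hr.
    rewrite (Hdens r Hr), (halpha r Hr).
    rewrite (is_derive_unique _ _ _ (Hda r Hr)).
    specialize (Hs r Hr); specialize (Hs2 r Hr).
    set (s := sqrt (1 - r ^ 2 / Rc ^ 2)) in *; rewrite <- Hs2; clearbody s.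
    (* Again [s ^ 2] is expanded by hand; the two contributions [1 / Rc ^ 2] and [2 / Rc ^ 2] add up
       to [3 / Rc ^ 2]. *)
    replace (s ^ 2 / r ^ 2 * (1 - r * (2 * r / (Rc ^ 2 * s ^ 2))))
      with ((1 - r ^ 2 / Rc ^ 2) / r ^ 2 - 2 / Rc ^ 2)
      by (rewrite <- Hs2; field; repeat split; auto; lra).
    field; repeat split; auto; lra.
Qed.
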